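(* There is an absolute constant $C_1>0$ such that for every $d\ge2$ and $1\le s\le d$ there exists an action set $\mathcal{A}\subset[-1,1]^d$ for which, for every probability measure $\mu$ on $\mathcal{A}$ with $\Sigma:=Q(\mu)$ positive definite, $$H_*<C_1\,\frac sd\cdot\frac1{\phi_0^2(\Sigma,s)} .$$
   Context: For a probability measure $\mu$ on $\mathcal{A}$, $Q(\mu)=\int aa^\top d\mu(a)$. $H_*:=\sqrt{H_*^2}$ where $H_*^2=\min_{\mu}\max_{i\in[d]}(Q(\mu)^{-1})_{ii}$ over probability measures on $\mathcal{A}$ (objective $+\infty$ if $Q(\mu)$ is singular). Compatibility constant: for positive definite $\Sigma\in\mathbb{R}^{d\times d}$ and $s\in[d]$, $$\phi_0^2(\Sigma,s):=\min_{S\subseteq[d]:|S|=s}\ \min_{v:\ \|v_{-S}\|_1\le3\|v_S\|_1,\ v_S\ne0}\frac{s\,v^\top\Sigma v}{\|v_S\|_1^2},$$ where $v_S\in\mathbb{R}^d$ agrees with $v$ on coordinates in $S$ and is $0$ elsewhere, and $v_{-S}=v-v_S$. *)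

(* Defs.v *)
From HB Require Import structures.
From mathcomp Require Import all_boot all_order all_algebra.
From mathcomp Require Import all_classical all_reals all_analysis.

Set Implicit Arguments.
Unset Strict Implicit.
Unset Printing Implicit Defensive.

Import Order.TTheory GRing.Theory Num.Theory.
Import numFieldNormedType.Exports.
Local Open Scope classical_set_scope.
Local Open Scope ring_scope.

(* R^d with its Borel sigma-algebra. *)
Notation borel_cV R d := (g_sigma_algebraType (@open 'cV[R]_d)).

Definition cube (R : realType) (d : nat) : set 'cV[R]_d :=
  [set a | forall i, -1 <= a i 0 <= 1].

(* A probability measure on a measurable set A is represented by a Borel
   probability measure on R^d that gives mass 1 to A. *)
Definition prob_on (R : realType) (d : nat) (A : set (borel_cV R d))
    (mu : probability (borel_cV R d) R) : Prop :=
  mu A = 1%E.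

(* The matrix integral is taken entrywise; the integrands are bounded on A as
   soon as A is included in the cube. *)
Definition Qmx (R : realType) (d : nat) (A : set (borel_cV R d))
    (mu : probability (borel_cV R d) R) : 'M[R]_d :=
  \matrix_(i, j)
    (\int[mu]_(a in A) (((a : 'cV[R]_d) *m (a : 'cV[R]_d)^T) i j)).

Definition posdefmx (R : realType) (d : nat) (M : 'M[R]_d) : Prop :=
  M^T = M /\ forall v : 'cV[R]_d, v != 0 -> 0 < (v^T *m M *m v) 0 0.

Definition design_cost (R : realType) (d : nat) (A : set (borel_cV R d))
    (mu : probability (borel_cV R d) R) : \bar R :=
  if Qmx A mu \in unitmx
  then (\big[maxe/-oo]_(i < d) ((invmx (Qmx A mu)) i i)%:E)%E
  else +oo%E.

Definition Hstar_sq (R : realType) (d : nat) (A : set (borel_cV R d)) : \bar R :=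
  ereal_inf [set design_cost A mu | mu in prob_on A].

Definition Hstar (R : realType) (d : nat) (A : set (borel_cV R d)) : \bar R :=
  sqrte (Hstar_sq A).

(* The infimum defining Hstar_sq is a genuine minimum, with a finite value; in
   particular some probability measure on A has a nonsingular Qmx. *)
Definition Hstar_well_defined (R : realType) (d : nat)
    (A : set (borel_cV R d)) : Prop :=
  (Hstar_sq A < +oo)%E /\
  exists mu, prob_on A mu /\ design_cost A mu = Hstar_sq A.

Definition norm1 (R : realType) (d : nat) (v : 'cV[R]_d) : R :=
  \sum_(i < d) `|v i 0|.

Definition restr (R : realType) (d : nat) (S : {set 'I_d}) (v : 'cV[R]_d) :
    'cV[R]_d :=
  \col_i (if i \in S then v i 0 else 0).

Definition compat_cone (R : realType) (d : nat) (S : {set 'I_d}) :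
    set 'cV[R]_d :=
  [set v | norm1 (v - restr S v) <= 3 * norm1 (restr S v) /\ restr S v != 0].

(* For M positive definite and 1 <= s <= d both infima range over nonempty sets
   of nonnegative reals, and by homogeneity and compactness they are attained. *)
Definition phi0_sq (R : realType) (d : nat) (M : 'M[R]_d) (s : nat) : R :=
  inf [set inf [set s%:R * (v^T *m M *m v) 0 0 / norm1 (restr S v) ^+ 2
               | v in compat_cone (R := R) S]
      | S in [set S : {set 'I_d} | #|S| = s]].

(* Main.v *)
(* Take A = {e_1/d, e_2, ..., e_d}. Every Q(mu) is then diagonal, with entries
   p_i alpha_i^2, where p_i is the mass of the i-th point and alpha_i its
   length. Equalizing the entries of the inverse gives
   H_*^2 = sum_i alpha_i^-2 = d^2 + d - 1 < (2d)^2. On the other hand, testing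
   the compatibility constant with v = e_1 and any S containing 1 gives
   phi_0^2(Q(mu), s) <= s p_1 / d^2 <= s / d^2, so that
   (s/d) / phi_0^2 >= d > H_* / 2. *)
Require Import Defs.
From HB Require Import structures.
From mathcomp Require Import all_boot all_order all_algebra.
From mathcomp Require Import all_classical all_reals all_analysis.
From mathcomp Require Import ring lra.

Set Implicit Arguments.
Unset Strict Implicit.

Import Order.TTheory GRing.Theory Num.Theory.
Import numFieldNormedType.Exports.
Local Open Scope classical_set_scope.
Local Open Scope ring_scope.

(** * Diagonal matrices, and a Cauchy-Schwarz inequality *)

Lemma unitmx_diag (F : fieldType) n (q : 'rV[F]_n) :
  (diag_mx q \in unitmx) = [forall i, q 0 i != 0].
Proof.
rewrite unitmxE unitfE det_diag; apply/prodf_neq0/forallP => [h i|h i _].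
  exact: h.
exact: h.
Qed.

Lemma invmx_diag (F : fieldType) n (q : 'rV[F]_n) :
  diag_mx q \in unitmx -> invmx (diag_mx q) = diag_mx (\row_i (q 0 i)^-1).
Proof.
move=> qU; apply: (can_inj (mulKmx qU)); rewrite mulmxV// mulmx_diag.
apply/matrixP => i j; rewrite !mxE.
by move: qU; rewrite unitmx_diag => /forallP/(_ i) qi; rewrite divff.
Qed.

Lemma quad_diag (F : fieldType) n (q : 'rV[F]_n) (v : 'cV[F]_n) :
  (v^T *m diag_mx q *m v) 0 0 = \sum_i q 0 i * v i 0 ^+ 2.
Proof.
rewrite !mxE; apply: eq_bigr => i _; rewrite mul_mx_diag !mxE.
by rewrite expr2 mulrA [v _ _ * _]mulrC.
Qed.

(** Cauchy-Schwarz against the all-ones vector: sum [2 * x i * x j <= x i ^+ 2 + x j ^+ 2] over all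
    pairs, then cancel the factor 2. *)
Lemma sqr_sum_le (R : realFieldType) n (x : 'I_n -> R) :
  (\sum_i x i) ^+ 2 <= n%:R * \sum_i x i ^+ 2.
Proof.
have le2 : (\sum_i x i) ^+ 2 *+ 2 <=
           \sum_i \sum_j (x i ^+ 2 + x j ^+ 2).
  rewrite expr2 mulr_suml -sumrMnl ler_sum// => i _.
  rewrite mulr_sumr -sumrMnl ler_sum// => j _.
  by have := sqr_ge0 (x i - x j); lra.
have sumE : \sum_i \sum_j (x i ^+ 2 + x j ^+ 2) =
            (n%:R * \sum_i x i ^+ 2) *+ 2.
  under eq_bigr do rewrite big_split /= sumr_const card_ord.
  by rewrite big_split /= sumrMnl sumr_const card_ord mulr2n mulr_natl.
by move: le2; rewrite sumE ler_pMn2r.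
Qed.

(** * Upper and lower bounds on the compatibility constant *)

Section compatibility.
Context {R : realType} {n : nat}.
Implicit Types (S : {set 'I_n}) (v : 'cV[R]_n) (M : 'M[R]_n).

Lemma norm1_ge0 v : 0 <= norm1 v.
Proof. by apply: sumr_ge0 => i _. Qed.

Lemma norm1_eq0 v : (norm1 v == 0) = (v == 0).
Proof.
apply/eqP/eqP => [v0|->]; last by apply: big1 => i _; rewrite mxE normr0.
apply/matrixP => i j; rewrite ord1 mxE; apply/eqP; rewrite -normr_eq0.
by move/psumr_eq0P : v0 => ->.
Qed.

Lemma norm1_restr_sq_le S v :
  norm1 (restr S v) ^+ 2 <= n%:R * \sum_i v i 0 ^+ 2.
Proof.
apply: (le_trans (@sqr_sum_le _ _ (fun i => `|restr S v i 0|))).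
apply: ler_wpM2l => //; apply: ler_sum => i _.
rewrite !mxE -normrX; case: ifP => _; first by rewrite ger0_norm ?sqr_ge0.
by rewrite expr0n normr0 sqr_ge0.
Qed.

Lemma delta_compat_cone S i : i \in S ->
  restr S (delta_mx i 0 : 'cV[R]_n) = delta_mx i 0 /\
  compat_cone S (delta_mx i 0 : 'cV[R]_n).
Proof.
move=> iS; have rE : restr S (delta_mx i 0 : 'cV[R]_n) = delta_mx i 0.
  apply/matrixP => j k; rewrite !mxE ord1 eqxx andbT.
  by have [->|_] := eqVneq j i; [rewrite iS | case: ifP].
split => //; rewrite /compat_cone /= rE subrr; split.
  have /eqP -> : norm1 (0 : 'cV[R]_n) == 0 by rewrite norm1_eq0.
  by rewrite mulr_ge0// norm1_ge0.
by apply/eqP => /matrixP/(_ i 0); rewrite !mxE !eqxx; apply/eqP/oner_neq0.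
Qed.

Lemma norm1_delta i : norm1 (delta_mx i 0 : 'cV[R]_n) = 1.
Proof.
rewrite /norm1 (bigD1 i)//= big1 => [|j ji]; rewrite mxE ?eqxx ?normr1 ?addr0//.
by rewrite (negbTE ji) normr0.
Qed.

(** The basis vector at [i] lies in the cone of [S] and its restriction has norm 1, so its quotient
    is [s%:R * M i i]. Nonnegativity of the form bounds both sets below by 0, as comparing an [inf]
    with a member requires. *)
Lemma phi0_sq_le M s S i :
  (forall v, 0 <= (v^T *m M *m v) 0 0) -> #|S| = s -> i \in S ->
  phi0_sq M s <= s%:R * M i i.
Proof.
move=> M0 Ss iS.
have val0 S' v : 0 <= s%:R * (v^T *m M *m v) 0 0 / norm1 (restr S' v) ^+ 2.
  by rewrite divr_ge0 ?sqr_ge0// mulr_ge0.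
have inner0 S' : 0 <= inf [set s%:R * (v^T *m M *m v) 0 0
    / norm1 (restr S' v) ^+ 2 | v in compat_cone (R := R) S'].
  (* When the cone is empty, as for empty [S'], the real [inf] takes its default value 0. *)
  have [->|/set0P ne] := eqVneq [set s%:R * (v^T *m M *m v) 0 0
    / norm1 (restr S' v) ^+ 2 | v in compat_cone (R := R) S'] set0.
    by rewrite inf0.
  by apply: lb_le_inf => // _ [v _ <-].
apply: (@le_trans _ _ (inf [set s%:R * (v^T *m M *m v) 0 0
    / norm1 (restr S v) ^+ 2 | v in compat_cone (R := R) S])).
  apply: ge_inf; last by exists S.
  by exists 0 => _ [S' _ <-].
apply: ge_inf; first by exists 0 => _ [v _ <-].
have [rE dS] := delta_compat_cone iS.
exists (delta_mx i 0) => //.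
rewrite rE norm1_delta expr1n divr1 trmx_delta -rowE -colE.
by rewrite !mxE.
Qed.

(** By Cauchy-Schwarz the squared l1 norm of a restriction is at most [n] times the squared
    Euclidean norm, which the form controls through [c]. With [c > 0] this makes the constant
    strictly positive. *)
Lemma phi0_sq_ge M s S (c : R) :
  (0 < s)%N -> #|S| = s -> 0 <= c ->
  (forall v, c * \sum_i v i 0 ^+ 2 <= (v^T *m M *m v) 0 0) ->
  s%:R * c / n%:R <= phi0_sq M s.
Proof.
move=> s0 Ss c0 cM; apply: lb_le_inf; first by eexists; exists S.
move=> _ [S' /= S's <-]; apply: lb_le_inf.
  (* The inner set must be inhabited, since an empty [inf] would be 0; [0 < s] provides a basis
     vector in the cone. *)
  have /card_gt0P[i iS'] : (0 < #|S'|)%N by rewrite S's.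
  by eexists; exists (delta_mx i 0); have [] := delta_compat_cone iS'.
move=> _ [v [_ v0] <-].
have n0 : 0 < n%:R :> R.
  by rewrite ltr0n (leq_trans s0)// -S's -[leqRHS]card_ord max_card.
have N0 : 0 < norm1 (restr S' v) ^+ 2.
  by rewrite exprn_gt0// lt_neqAle norm1_ge0 andbT eq_sym norm1_eq0.
rewrite ler_pdivlMr// mulrAC ler_pdivrMr// -!mulrA ler_wpM2l//.
apply: (@le_trans _ _ (c * (n%:R * \sum_i v i 0 ^+ 2))).
  by rewrite ler_wpM2l// norm1_restr_sq_le.
by rewrite mulrCA mulrC ler_wpM2r// ltW.
Qed.

End compatibility.

(** * Optimal design on scaled basis vectors *)

Section scaled_axes.
Context {R : realType} {n : nat} (alpha : nat -> R).
Context (alpha_gt0 : forall k, 0 < alpha k).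
Let T := borel_cV R n.+1.

Definition axis_point (k : nat) : 'cV[R]_n.+1 :=
  \col_(i < n.+1) (if i == k :> nat then alpha k else 0).

Definition axis_set : set T :=
  \bigcup_(k in `I_n.+1) [set (axis_point k : T)].

Lemma measurable_point (x : 'cV[R]_n.+1) : measurable ([set x] : set T).
Proof.
rewrite -[X in measurable X]setCK; apply: measurableC.
apply: sub_sigma_algebra; apply: closed_openC.
exact/accessible_closed_set1/hausdorff_accessible/norm_hausdorff.
Qed.

Lemma measurable_axis_set : measurable axis_set.
Proof.
apply: fin_bigcup_measurable => [|k _]; first exact: finite_II.
exact: measurable_point.
Qed.

Lemma axis_point_inj : {in `I_n.+1 &, injective axis_point}.
Proof.
move=> k l; rewrite !inE /= => kn ln /matrixP/(_ (Ordinal kn) 0).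
rewrite !mxE /= eqxx; case: eqP => // _ k0.
by have := alpha_gt0 k; rewrite k0 ltxx.
Qed.

Lemma axis_points_disjoint :
  trivIset `I_n.+1 (fun k => [set (axis_point k : T)]).
Proof.
move=> k l kn ln [x [/= -> kl]].
by apply: axis_point_inj; rewrite ?inE.
Qed.

Definition axis_mass (mu : probability T R) (k : nat) : R :=
  fine (mu [set (axis_point k : T)]).

Lemma axis_mass_ge0 mu k : 0 <= axis_mass mu k.
Proof. exact/fine_ge0/measure_ge0. Qed.

Lemma sum_axis_mass (mu : probability T R) :
  prob_on axis_set mu -> \sum_(i < n.+1) axis_mass mu i = 1.
Proof.
move=> muA; apply: EFin_inj; rewrite -muA /axis_set.
rewrite measure_fin_bigcup//=.
- rewrite -fsbig_ord -sumEFin; apply: eq_bigr => i _.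
  by rewrite /axis_mass fineK// fin_num_measure//; exact: measurable_point.
- exact: axis_points_disjoint.
- by move=> k _; exact: measurable_point.
Qed.

Lemma Qmx_axis_set (mu : probability T R) :
  Qmx axis_set mu = diag_mx (\row_i (alpha i ^+ 2 * axis_mass mu i)).
Proof.
apply/matrixP => i j; rewrite !mxE.
(* On [axis_set], the product of coordinates [i] and [j] vanishes except at the [i]-th point when
   [i = j], so the integrand is a constant supported on one singleton. *)
transitivity (\int[mu]_(a in axis_set)
  ((cst (alpha i ^+ 2 *+ (i == j))) \_ [set (axis_point i : T)]) a).
  apply: eq_Rintegral => a; rewrite inE => -[k /= kn ->].
  rewrite mxE big_ord1 !mxE patchE.
  have [ik|ik] := eqVneq (i : nat) k.
    rewrite ik mem_set//= -ik.
    have [->|ij] := eqVneq i j; first by rewrite eqxx mulr1n expr2.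
    rewrite [_ == _ :> nat]eq_sym.
    by rewrite (negbTE ij : (i == j :> nat) = false) mulr0.
  rewrite mul0r memNset// => /= kE; move/eqP: ik; apply.
  by apply/esym/axis_point_inj; rewrite ?inE//=.
rewrite -Rintegral_mkcondr setIidr; last first.
  by move=> _ ->; exists i => //=.
rewrite Rintegral_cst; last exact: measurable_point.
by have [->|] := eqVneq i j; rewrite ?mulr1n// mulr0n mul0r.
Qed.

(** Both the optimal cost and the normalizing constant of the optimal design. *)
Definition axis_norm : R := \sum_(i < n.+1) alpha i ^- 2.

Lemma axis_norm_gt0 : 0 < axis_norm.
Proof.
rewrite /axis_norm big_ord_recl ltr_pwDl ?invr_gt0 ?exprn_gt0//.
by apply: sumr_ge0 => i _; rewrite invr_ge0 exprn_ge0// ltW.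
Qed.

(** Some diagonal entry is at most [axis_norm^-1]: otherwise each mass would exceed
    [alpha i ^- 2 / axis_norm], and summing would give [1 < 1]. The inverse of that entry is at
    least [axis_norm]. *)
Lemma axis_norm_le_design_cost (mu : probability T R) :
  prob_on axis_set mu -> (axis_norm%:E <= design_cost axis_set mu)%E.
Proof.
move=> muA; rewrite /design_cost Qmx_axis_set//.
set q := \row_i _; case: ifPn => [qU|_]; last exact: leey.
have q0 i : 0 < q 0 i.
  rewrite lt_neqAle eq_sym; move: (qU); rewrite unitmx_diag => /forallP ->/=.
  by rewrite mxE mulr_ge0 ?sqr_ge0 ?axis_mass_ge0.
rewrite invmx_diag//.
have [i qi] : exists i : 'I_n.+1, q 0 i <= axis_norm^-1.
  apply: contrapT => /forallNP h.
  suff : \sum_(i < n.+1) alpha i ^- 2 / axis_norm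
         < \sum_(i < n.+1) axis_mass mu i.
    by rewrite -mulr_suml sum_axis_mass// divff ?ltxx// gt_eqF// axis_norm_gt0.
  apply: ltr_sum => [|i _];
    first by apply/hasP; exists ord0; rewrite ?mem_index_enum.
  have /negP := h i; rewrite -ltNge mxE => hi.
  by rewrite mulrC ltr_pdivrMr ?exprn_gt0// mulrC.
apply: le_trans (le_bigmax _ _ i).
rewrite lee_fin mxE eqxx mulr1n mxE -[leLHS]invrK.
by rewrite lef_pV2 ?posrE ?invr_gt0 ?axis_norm_gt0.
Qed.

Definition axis_weight (k : nat) : {nonneg R} := NngNum (sqr_ge0 (alpha k)^-1).

(** Masses proportional to [alpha i ^- 2] equalize the diagonal entries. The last Dirac measure is
    only the fallback of [mnormalize] for a zero or infinite total mass; here the total is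
    [axis_norm]. *)
Definition axis_prob : probability T R :=
  mnormalize
    (msum (fun k => mscale (axis_weight k) (dirac (axis_point k : T))) n.+1)
    (dirac (axis_point 0 : T)).

Lemma axis_probE (U : set T) : axis_prob U =
  ((\sum_(i < n.+1 | (axis_point i : T) \in U) alpha i ^- 2) / axis_norm)%:E.
Proof.
pose m : {measure set T -> \bar R} :=
  msum (fun k => mscale (axis_weight k) (dirac (axis_point k : T))) n.+1.
have mE V : m V =
    (\sum_(i < n.+1 | (axis_point i : T) \in V) alpha i ^- 2)%:E.
  rewrite -sumEFin [RHS]big_mkcond; apply: eq_bigr => i _.
  transitivity (((alpha i)^-1 ^+ 2)%:E * \d_(axis_point i : T) V)%E => //.
  rewrite diracE -EFinM exprVn.
  by case: ifPn => _; rewrite ?mulr1 ?mulr0.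
have mT : m setT = axis_norm%:E.
  by rewrite mE; congr EFin; apply: eq_bigl => i; rewrite mem_set.
rewrite -[LHS]/(mnormalize m (dirac (axis_point 0 : T)) U) /mnormalize mT.
by rewrite eqe gt_eqF ?axis_norm_gt0//= mE EFinM.
Qed.

Lemma axis_prob_on : prob_on axis_set axis_prob.
Proof.
rewrite /prob_on axis_probE (eq_bigl xpredT) => [|i].
  by rewrite divff// gt_eqF// axis_norm_gt0.
by rewrite mem_set//; exists i => /=.
Qed.

Lemma axis_mass_prob (k : 'I_n.+1) :
  axis_mass axis_prob k = alpha k ^- 2 / axis_norm.
Proof.
rewrite /axis_mass axis_probE (big_pred1 k)// => i /=.
apply/idP/eqP => [|->]; last by rewrite mem_set.
by rewrite inE /= => /axis_point_inj ik; apply/val_inj/ik; rewrite inE /=.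
Qed.

Lemma design_cost_axis_prob : design_cost axis_set axis_prob = axis_norm%:E.
Proof.
rewrite /design_cost Qmx_axis_set.
have -> : \row_(i < n.+1) (alpha i ^+ 2 * axis_mass axis_prob i) =
          const_mx axis_norm^-1.
  apply/rowP => i; rewrite !mxE axis_mass_prob mulrA divff ?mul1r//.
  by rewrite expf_neq0// gt_eqF.
have N0 := axis_norm_gt0.
have U : diag_mx (const_mx axis_norm^-1 : 'rV_n.+1) \in unitmx.
  by rewrite unitmx_diag; apply/forallP => i; rewrite mxE invr_eq0 gt_eqF.
rewrite U invmx_diag//; apply/le_anti/andP; split.
  apply: bigmax_le => [|i _]; first exact: leNye.
  by rewrite !mxE eqxx mulr1n invrK.
apply: le_trans (le_bigmax _ _ ord0).
by rewrite !mxE eqxx mulr1n invrK.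
Qed.

Lemma Hstar_sq_axis_set : Hstar_sq axis_set = axis_norm%:E.
Proof.
apply/le_anti/andP; split.
  apply: ereal_inf_lbound; exists axis_prob; first exact: axis_prob_on.
  exact: design_cost_axis_prob.
by apply: le_ereal_inf_tmp => _ [mu muA <-]; exact: axis_norm_le_design_cost.
Qed.

Lemma Hstar_well_defined_axis_set : Hstar_well_defined axis_set.
Proof.
rewrite /Hstar_well_defined Hstar_sq_axis_set ltry; split => //.
by exists axis_prob; split; [exact: axis_prob_on|exact: design_cost_axis_prob].
Qed.

End scaled_axes.

(** * The instance with one short axis, and the conclusion *)

Lemma axis_set_cube (R : realType) (n : nat) (alpha : nat -> R) :
  (forall k, 0 < alpha k <= 1) -> axis_set (n := n) alpha `<=` cube (d := n.+1).
Proof.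
move=> alpha01 _ [k /= _ ->] i; have /andP[a0 a1] := alpha01 k.
by rewrite !mxE; case: ifP => _; [rewrite a1 andbT; lra|lra].
Qed.

Lemma card_ord_lt (n s : nat) : (s <= n)%N ->
  #|[set i : 'I_n | (i < s)%N]%SET| = s.
Proof.
move=> sn; rewrite -sum1dep_card (big_ord_narrow sn).
by rewrite sum1_card card_ord.
Qed.

Unset Implicit Arguments.

Theorem proposition3 (R : realType) :
  exists C1 : R, 0 < C1 /\
  forall d s : nat, (2 <= d)%N -> (1 <= s <= d)%N ->
  exists A : set (borel_cV R d),
    measurable A /\ A `<=` cube (R := R) (d := d) /\ Hstar_well_defined A /\
    forall mu : probability (borel_cV R d) R,
      prob_on A mu -> posdefmx (Qmx A mu) ->
      (Hstar A < (C1 * (s%:R / d%:R) * (1 / phi0_sq (Qmx A mu) s))%:E)%E.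
Proof.
exists 2; split => // -[//|n] s _ /andP[s0 sn].
set D : R := n.+1%:R; have D1 : 1 <= D by rewrite ler1n.
have D0 : 0 < D by rewrite ltr0n.
have s_gt0 : 0 < s%:R :> R by rewrite ltr0n.
(* Index 0 carries the short axis, that is, the first coordinate. *)
pose alpha (k : nat) : R := if k is 0%N then D^-1 else 1.
have alpha01 k : 0 < alpha k <= 1.
  by case: k => [|k] /=; rewrite ?ltr01 ?lexx// invr_gt0 D0 invf_le1.
have alpha0 k : 0 < alpha k by have /andP[] := alpha01 k.
have normE : axis_norm (n := n) alpha = D ^+ 2 + (D - 1).
  rewrite /axis_norm big_ord_recl/= exprVn invrK; congr (_ + _).
  rewrite (eq_bigr (fun=> 1)) => [|i _]; last by rewrite expr1n invr1.
  by rewrite sumr_const card_ord /D -natr1 addrK.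
exists (axis_set alpha); split; first exact: measurable_axis_set.
split; first exact: axis_set_cube.
split; first exact: Hstar_well_defined_axis_set.
move=> mu muA [_ pd].
set M := Qmx _ _ in pd *.
have ME : M = diag_mx (\row_i (alpha i ^+ 2 * axis_mass alpha mu i)).
  exact: Qmx_axis_set.
set q := \row_i _ in ME.
(* Positive definiteness is tested on the basis vectors. *)
have q0 i : 0 < q 0 i.
  have := pd (delta_mx i 0); rewrite ME quad_diag.
  rewrite (bigD1 i)//= big1 => [|j ji].
    rewrite [delta_mx _ _ _ _]mxE !eqxx expr1n mulr1 addr0; apply.
    by apply/eqP => /matrixP/(_ i 0); rewrite !mxE !eqxx; apply/eqP/oner_neq0.
  by rewrite [delta_mx _ _ _ _]mxE (negbTE ji) expr0n mulr0.
have M0 (v : 'cV[R]_n.+1) : 0 <= (v^T *m M *m v) 0 0.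
  by rewrite ME quad_diag sumr_ge0// => i _; rewrite mulr_ge0 ?sqr_ge0// ltW.
have cardS := card_ord_lt sn.
(* Strict positivity matters: with [phi0_sq M s = 0] the quotient [1 / phi0_sq M s] would be 0. The
   witness [c] is the least diagonal entry, capped at 1. *)
have phi_gt0 : 0 < phi0_sq M s.
  pose c := \big[Num.min/1]_i q 0 i.
  have c0 : 0 < c by apply: lt_bigmin.
  apply: (@lt_le_trans _ _ (s%:R * c / D)).
    by rewrite divr_gt0// mulr_gt0.
  apply: (phi0_sq_ge s0 cardS (ltW c0)) => v.
  rewrite ME quad_diag mulr_sumr; apply: ler_sum => i _.
  by rewrite ler_wpM2r ?sqr_ge0// bigmin_le.
(* The first [s] indices contain [ord0], where the entry of [M] is [D ^- 2] times a mass at most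
   1. *)
have phi_le : phi0_sq M s <= s%:R / D ^+ 2.
  apply: (le_trans (@phi0_sq_le _ _ M s _ ord0 M0 cardS _)).
    by rewrite inE.
  rewrite ler_wpM2l// ME !mxE eqxx mulr1n /= exprVn ler_piMr//.
    by rewrite invr_ge0 sqr_ge0.
  rewrite -(sum_axis_mass alpha0 muA) big_ord_recl lerDl.
  by apply: sumr_ge0 => i _; exact: axis_mass_ge0.
have HE : Hstar (axis_set alpha : set (borel_cV R n.+1)) =
          (Num.sqrt (D ^+ 2 + (D - 1)))%:E.
  by rewrite /Hstar Hstar_sq_axis_set// normE.
(* The constant 2 works because [D ^+ 2 + (D - 1) < (2 * D) ^+ 2] for [1 <= D]; the other half is
   [phi_le] multiplied by [D]. *)
rewrite HE lte_fin; apply: (@lt_le_trans _ _ (2 * D)).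
  rewrite -[ltRHS]gtr0_norm ?mulr_gt0// -sqrtr_sqr.
  rewrite ltr_sqrt ?exprn_gt0 ?mulr_gt0//; nra.
rewrite -mulrA ler_wpM2l// mul1r ler_pdivlMr//.
apply: (le_trans (ler_wpM2l (ltW D0) phi_le)).
by rewrite le_eqVlt; apply/orP; left; apply/eqP; field; rewrite gt_eqF.
Qed.
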